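(* Assume the setup of the context and that $\mu$ is not a Dirac mass. Then for every matrix $F\in\mathbb R^{d^+\times d^-}$ there exists an admissible $v$ such that the limit defining $E_0(v)$ exists and $E_0(v)=F$.
   Context: Let $r\ge1$, $\Lambda\subset\mathbb R^m$ compact, and $g\in C^r(\mathbb R^m,\mathbb R^m)$ such that $\Lambda$ is invariant under the flow $g_t$ of $\dot y=g(y)$. Let $\mu$ be a Borel probability measure on $\Lambda$ that is $g_t$-invariant, ergodic and mixing. Let $R\in\mathbb R^{m\times m}$ with $R^2=I$, $R(\Lambda)=\Lambda$, $\mu$ $R$-invariant, and $g(Ry)=-Rg(y)$ for all $y\in\Lambda$. Let $d=d^++d^-$ and $A=\mathrm{diag}(I_{d^+},-I_{d^-})$. A function $v\in C^r(\mathbb R^m,\mathbb R^d)$ is admissible if $v(Ry)=Av(y)$ for all $y\in\Lambda$ and $\int_\Lambda v\,d\mu=0$; write $v=(v^+,v^-)$ with $v^\pm$ valued in $\mathbb R^{d^\pm}$ and set $E_0(v)=2\lim_{T\to\infty}\int_0^T\int_\Lambda v^+\otimes(v^-\circ g_t)\,d\mu\,dt\in\mathbb R^{d^+\times d^-}$, where $u\otimes w=uw^T$. *)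

(* Defs.v *)
From HB Require Import structures.
From mathcomp Require Import all_boot all_order all_algebra.
From mathcomp Require Import all_classical all_reals all_analysis.
Set Implicit Arguments. Unset Strict Implicit. Unset Printing Implicit Defensive.
Import Order.TTheory GRing.Theory Num.Theory.
Import numFieldNormedType.Exports.
Local Open Scope classical_set_scope.
Local Open Scope ring_scope.

(* R^m is represented by column vectors 'cV[R]_m with the normed-space
   topology; [Rm R m] is the same carrier equipped with the Borel
   sigma-algebra (sigma-algebra generated by the open sets). *)
Definition Rm (R : realType) (m : nat) := g_sigma_algebraType (@open 'cV[R]_m).
Definition Rm_display (R : realType) (m : nat) := sigma_display (@open 'cV[R]_m).

Fixpoint Ck (R : realType) (m n : nat) (k : nat) (f : 'cV[R]_m -> 'cV[R]_n)
  : Prop :=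
  match k with
  | 0%N => continuous f
  | k'.+1 => (forall x, differentiable f x) /\
             (forall u : 'cV[R]_m, Ck k' (fun x => 'D_u f x))
  end.

Definition is_flow_on (R : realType) (m : nat) (g : 'cV[R]_m -> 'cV[R]_m)
  (Lam : set 'cV[R]_m) (phi : R -> 'cV[R]_m -> 'cV[R]_m) : Prop :=
  forall y, Lam y ->
    phi 0 y = y /\
    forall t : R, Lam (phi t y) /\
      is_derive t (1 : R) (fun s => phi s y) (g (phi t y)).

Definition Amat (R : realType) (dp dm : nat) : 'M[R]_(dp + dm) :=
  block_mx 1%:M 0 0 (- 1%:M).

Definition vplus (R : realType) (m dp dm : nat)
  (v : 'cV[R]_m -> 'cV[R]_(dp + dm)) (i : 'I_dp) (y : 'cV[R]_m) : R :=
  v y (lshift dm i) 0.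
Definition vminus (R : realType) (m dp dm : nat)
  (v : 'cV[R]_m -> 'cV[R]_(dp + dm)) (j : 'I_dm) (y : 'cV[R]_m) : R :=
  v y (rshift dp j) 0.

Definition admissible (R : realType) (m dp dm r : nat)
  (Lam : set 'cV[R]_m) (mu : probability (Rm R m) R) (Rf : 'M[R]_m)
  (v : 'cV[R]_m -> 'cV[R]_(dp + dm)) : Prop :=
  Ck r v /\
  (forall y, Lam y -> v (Rf *m y) = Amat R dp dm *m v y) /\
  (forall k : 'I_(dp + dm),
      (\int[mu]_(y in (Lam : set (Rm R m))) (v y k 0)%:E = 0)%E).

Definition E0_partial (R : realType) (m dp dm : nat)
  (Lam : set 'cV[R]_m) (mu : probability (Rm R m) R)
  (phi : R -> 'cV[R]_m -> 'cV[R]_m)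
  (v : 'cV[R]_m -> 'cV[R]_(dp + dm)) (i : 'I_dp) (j : 'I_dm) (T : R) : R :=
  2 * Rintegral (@lebesgue_measure R) `[0, T]
        (fun t => Rintegral mu (Lam : set (Rm R m))
           (fun y => vplus v i y * vminus v j (phi t y))).

(* Main.v *)
(** The minus part is taken to be a coboundary.  If [w] is even under the
    reversing symmetry, its derivative [dw] along the flow is odd, and for an
    even mean-zero [v] the time integral of the correlation of [v] with
    [dw \o phi t] telescopes to the correlation of [v] with [w \o phi t] minus
    the integral of [v * w]; the former vanishes at infinity by mixing.  Hence
    the limit is twice the negated L2 pairing of [v] and [w].
    Mixing and not being a Dirac mass exclude atoms, so one of the even
    functions [y_k + (R y)_k], [y_k * (R y)_k] takes infinitely many values (up
    to null sets): otherwise [y_k], a root of [X^2 - s X + p], would take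
    finitely many.  The centered powers of that function have an invertible
    Gram matrix, so every matrix of pairings is attained. *)
Require Import Defs.
From HB Require Import structures.
From mathcomp Require Import all_boot all_order all_algebra.
From mathcomp Require Import all_classical all_reals all_analysis.
From mathcomp Require Import measurable_realfun.
From mathcomp Require Import ring lra.
Import Order.TTheory GRing.Theory Num.Theory.
Import numFieldNormedType.Exports.
Local Open Scope classical_set_scope.
Local Open Scope ring_scope.
Set Implicit Arguments.
Unset Strict Implicit.
Unset Printing Implicit Defensive.

(** * Functions of class C^k *)

(** [Ck] is tied to maps between column vectors; the same recursion over arbitrary normed modules
    also covers scalar functions and composition with linear maps. *)
Fixpoint Cn {R : realType} {V W : normedModType R} (k : nat) (f : V -> W)
  : Prop :=
  match k with
  | 0%N => continuous f
  | k'.+1 => (forall x, differentiable f x) /\ (forall u, Cn k' ('D_u f))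
  end.

Section Cn_theory.
Context {R : realType} {V : normedModType R}.

Lemma Ck_Cn m n k (f : 'cV[R]_m -> 'cV[R]_n) : Ck k f <-> Cn k f.
Proof.
by elim: k f => [|k IH] f //=; split=> -[df Df]; split=> // u; apply/IH/Df.
Qed.

Lemma Cn_continuous (W : normedModType R) k (f : V -> W) :
  Cn k f -> continuous f.
Proof.
by case: k => [//|k] /= [df _] x; exact/differentiable_continuous/df.
Qed.

Lemma CnS (W : normedModType R) k (f : V -> W) : Cn k.+1 f -> Cn k f.
Proof.
elim: k f => [|k IH] f; first exact: Cn_continuous.
by move=> [df Df]; split => // u; exact: IH (Df u).
Qed.

Lemma Cn_cst (W : normedModType R) k (a : W) : Cn k (cst a : V -> W).
Proof.
elim: k a => [|k IH] a /=; first exact: cst_continuous.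
split=> [x|u]; first exact: differentiable_cst.
by rewrite (_ : 'D_u _ = cst 0) //; apply/funext => x; exact: derive_cst.
Qed.

Lemma CnD (W : normedModType R) k (f g : V -> W) :
  Cn k f -> Cn k g -> Cn k (f + g).
Proof.
elim: k f g => [|k IH] f g.
  by move=> cf cg x; apply: cvgD; [exact: cf|exact: cg].
move=> [df Df] [dg Dg]; split=> [x|u].
  by apply: differentiableD; [exact: df|exact: dg].
rewrite (_ : 'D_u _ = 'D_u f + 'D_u g); first exact: IH (Df u) (Dg u).
apply/funext => x; rewrite deriveD //; apply: diff_derivable.
  exact: df.
exact: dg.
Qed.

Lemma CnM k (f g : V -> R) : Cn k f -> Cn k g -> Cn k (f * g).
Proof.
elim: k f g => [|k IH] f g.
  by move=> cf cg x; apply: cvgM; [exact: cf|exact: cg].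
move=> Cf Cg; have [df Df] := Cf; have [dg Dg] := Cg.
split=> [x|u]; first by apply: differentiableM; [exact: df|exact: dg].
rewrite (_ : 'D_u _ = f * 'D_u g + g * 'D_u f).
  apply: CnD; apply: IH; first [exact: CnS|exact: Df|exact: Dg].
apply/funext => x; rewrite deriveM //; apply: diff_derivable.
  exact: df.
exact: dg.
Qed.

Lemma Cn_sum (W : normedModType R) k (n : nat) (f : 'I_n -> V -> W) :
  (forall i, Cn k (f i)) -> Cn k (fun x => \sum_i f i x).
Proof.
move=> Cf; rewrite (_ : (fun _ => _) = \sum_i f i).
  by elim/big_ind : _ => // [|? ?]; [exact: Cn_cst | exact: CnD].
by apply/funext => x; rewrite fct_sumE.
Qed.

Lemma Cn_horner k (p : {poly R}) (f : V -> R) :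
  Cn k f -> Cn k (fun x => p.[f x]).
Proof.
move=> Cf; elim/poly_ind: p => [|p c IH].
  by rewrite (_ : (fun _ => _) = cst 0); [exact: Cn_cst|
    apply/funext => x; rewrite horner0].
rewrite (_ : (fun _ => _) = (fun x => p.[f x]) * f + cst c).
  by apply: CnD; [exact: CnM | exact: Cn_cst].
by apply/funext => x; rewrite hornerMXaddC.
Qed.

(** A continuous linear map commutes with directional derivatives, so the induction applies to
    ['D_u f] with the same [L]. *)
Lemma Cn_linear_comp (W W' : normedModType R) k (L : {linear W -> W'})
  (f : V -> W) : continuous L -> Cn k f -> Cn k (L \o f).
Proof.
move=> cL; have dL y : differentiable L y by exact: linear_differentiable.
elim: k f => [|k IH] f /=.
  by move=> cf x; apply: continuous_comp; [exact: cf|exact: cL].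
move=> [df Df]; split=> [x|u].
  by apply: differentiable_comp; [exact: df|exact: dL].
rewrite (_ : 'D_u _ = L \o 'D_u f); first exact: IH (Df u).
apply/funext => x; rewrite deriveE; last exact: differentiable_comp.
by rewrite diff_comp //= diff_lin // -deriveE.
Qed.

Lemma Cn_id k : Cn k (@id V).
Proof.
case: k => [|k] /=; first by move=> x; exact: cvg_id.
split=> // u; rewrite (_ : 'D_u _ = cst u); first exact: Cn_cst.
by apply/funext => x; rewrite derive_id.
Qed.

Lemma Cn_coord k m n (f : V -> 'M[R]_(m, n)) i j :
  Cn k f -> Cn k (fun x => f x i j).
Proof.
have @L : {linear 'M[R]_(m, n) -> R}.
  by exists (fun N : 'M[R]_(_, _) => N i j); do 2![eexists]; do ?[constructor];
     rewrite ?mxE// => ? *; rewrite ?mxE//; move=> ?; rewrite !mxE.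
by apply: (@Cn_linear_comp _ _ k L); exact: coord_continuous.
Qed.

Lemma Cn_cV k n (f : V -> 'cV[R]_n) :
  (forall i, Cn k (fun x => f x i 0)) -> Cn k f.
Proof.
move=> Cf; rewrite (_ : f = fun x => \sum_i f x i 0 *: delta_mx i 0).
  apply: Cn_sum => i.
  have lin : linear ( *:%R ^~ (delta_mx i 0 : 'cV[R]_n) : R -> _).
    by move=> a b c; rewrite scalerDl scalerA.
  pose L : {linear R -> 'cV[R]_n} :=
    HB.pack ( *:%R ^~ (delta_mx i 0 : 'cV[R]_n))
      (GRing.isLinear.Build _ _ _ _ _ lin).
  exact: (@Cn_linear_comp _ _ k L _ (@scalel_continuous _ _ _)).
by apply/funext => x; rewrite [LHS]matrix_sum_delta; apply: eq_bigr => i _;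
  rewrite big_ord1.
Qed.

End Cn_theory.

(** * Regularity of the flow on the invariant set *)

Lemma compact_fun_bounded {R : realType} {T : topologicalType} (f : T -> R)
    (A : set T) :
  {within A, continuous f} -> compact A ->
  exists2 M : R, 0 <= M & forall x, A x -> `|f x| <= M.
Proof.
move=> cf cA; have [M [_ fM]] := compact_bounded (continuous_compact cf cA).
exists (`|M| + 1); first by rewrite addr_ge0.
move=> x Ax; apply: (fM (`|M| + 1)); last by exists x.
by rewrite (le_lt_trans (ler_norm _)) // ltrDl.
Qed.

Lemma is_derive_coord {R : realType} {V : normedModType R} m n
    (f : V -> 'M[R]_(m, n)) (t v : V) (df : 'M[R]_(m, n)) i j :
  is_derive t v f df -> is_derive t v (fun x => f x i j) (df i j).
Proof.
move=> [dft <-]; apply: DeriveDef; first exact: (derivable_mxP _ _ _).1.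
by rewrite derive_mx // mxE.
Qed.

Section sqdist.
Context {R : realType} {m : nat}.
Implicit Types x y : 'cV[R]_m.

(** The squared Euclidean distance: unlike the max norm carried by matrices, it can be
    differentiated along a pair of trajectories. *)
Definition sqdist x y : R := \sum_k (x k 0 - y k 0) ^+ 2.

Lemma sqr_le_sqdist x y k : (x k 0 - y k 0) ^+ 2 <= sqdist x y.
Proof.
rewrite /sqdist (bigD1 k) //= lerDl sumr_ge0 // => i _; exact: sqr_ge0.
Qed.

Lemma is_derive_line x y (n : nat) (g : 'cV[R]_m -> 'cV[R]_n) (s : R) :
  (forall z, differentiable g z) ->
  is_derive s 1 (fun h : R => g (h *: x + y)) ('D_x g (s *: x + y)).
Proof.
move=> dg.
have dl : is_diff s (fun h : R => h *: x + y) (fun h => h *: x).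
  have : is_diff s (( *:%R ^~ x) + cst y : R -> 'cV[R]_m) (( *:%R ^~ x) + 0).
    exact: is_diffD.
  by rewrite addr0.
have dl' : differentiable (fun h : R => h *: x + y) s by exact: ex_diff.
have dgl : differentiable (g \o (fun h : R => h *: x + y)) s.
  by apply: differentiable_comp.
apply: DeriveDef; first exact: diff_derivable.
rewrite deriveE // diff_comp //=.
by rewrite diff_val scale1r -deriveE.
Qed.

Lemma derive_expand (n : nat) (g : 'cV[R]_m -> 'cV[R]_n) x z (k : 'I_n) :
  differentiable g z ->
  'D_x g z k 0 = \sum_l x l 0 * 'D_(delta_mx l 0) g z k 0.
Proof.
move=> dg; rewrite deriveE // {1}[x]matrix_sum_delta linear_sum summxE.
apply: eq_bigr => l _; rewrite big_ord1 linearZ mxE deriveE //.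
Qed.

(* The mean value theorem is applied along segments, so the bound on the
   derivative is needed on the union of all segments between points of [A],
   which is again compact. *)
Lemma lipschitz_on_compact (g : 'cV[R]_m -> 'cV[R]_m) (r : nat)
    (A : set 'cV[R]_m) :
  Cn r.+1 g -> compact A ->
  exists K : R, forall x y, A x -> A y ->
    `|\sum_k (x k 0 - y k 0) * (g x k 0 - g y k 0)| <= K * sqdist x y.
Proof.
move=> [dg Dg] cA.
pose seg (p : 'cV[R]_m * 'cV[R]_m * R) := p.2 *: (p.1.1 - p.1.2) + p.1.2.
have cseg : continuous seg.
  move=> p; apply: cvgD; last first.
    by apply: cvg_comp; [exact: cvg_fst|exact: cvg_snd].
  apply: cvgZ; first exact: cvg_snd.
  apply: cvgB; first by apply: cvg_comp; [exact: cvg_fst|exact: cvg_fst].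
  by apply: cvg_comp; [exact: cvg_fst|exact: cvg_snd].
pose S := seg @` ((A `*` A) `*` `[0, 1]).
have cS : compact S.
  apply: continuous_compact; first exact: continuous_subspaceT.
  by apply: compact_setX; [exact: compact_setX|exact: segment_compact].
(* The sum of the absolute values of the Jacobian entries is continuous, hence bounded on the
   compact set [S]. *)
pose N z := \sum_k \sum_l `|'D_(delta_mx l 0) g z k 0|.
have cN : continuous N.
  have cD k l : continuous (fun z => 'D_(delta_mx l 0) g z k 0).
    exact: (Cn_continuous (Cn_coord k 0 (Dg (delta_mx l 0)))).
  apply: (@Cn_sum _ _ _ 0) => k; apply: (@Cn_sum _ _ _ 0) => l z.
  apply: (@continuous_comp _ _ _ (fun z => 'D_(delta_mx l 0) g z k 0) Num.norm).
    exact: cD.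
  exact: norm_continuous.
have [K K0 NK] := compact_fun_bounded (@continuous_subspaceT _ _ S _ cN) cS.
exists K => x y Ax Ay.
pose d : 'cV[R]_m := x - y.
(* Pairing [g] along the segment with the fixed vector [d] gives a scalar function, to which the
   mean value theorem applies; [f 1 - f 0] is the sum to be bounded. *)
pose f (s : R) := \sum_k d k 0 * g (s *: d + y) k 0.
pose df (s : R) := \sum_k d k 0 * 'D_d g (s *: d + y) k 0.
have fdf (s : R) : is_derive s (1 : R) f (df s).
  rewrite (_ : f = \sum_k (d k 0 \*o (fun s : R => g (s *: d + y) k 0))).
    apply: is_derive_sum => k; apply: is_deriveZ; apply: is_derive_coord.
    exact: is_derive_line.
  by apply/funext => t; rewrite fct_sumE.
have [c c01] : exists2 c, c \in `]0, 1[ & f 1 - f 0 = df c * (1 - 0).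
  apply: MVT => //; apply: derivable_within_continuous => s _.
  exact: ex_derive.
rewrite subr0 mulr1 => fE.
have -> : \sum_k (x k 0 - y k 0) * (g x k 0 - g y k 0) = f 1 - f 0.
  rewrite /f scale1r scale0r add0r subrK -sumrB; apply: eq_bigr => k _.
  by rewrite -mulrBr !mxE.
rewrite fE.
have Sc : S (c *: d + y).
  exists ((x, y), c) => //; split=> //=; exact: subset_itv_oo_cc c01.
apply: (@le_trans _ _ (N (c *: d + y) * sqdist x y)); last first.
  apply: ler_wpM2r; first by apply: sumr_ge0 => k _; exact: sqr_ge0.
  exact: le_trans (ler_norm _) (NK _ Sc).
rewrite /N mulr_suml (le_trans (ler_norm_sum _ _ _)) // ler_sum // => k _.
rewrite derive_expand // mulr_sumr mulr_suml (le_trans (ler_norm_sum _ _ _)) //.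
rewrite ler_sum // => l _; rewrite mulrA normrM mulrC ler_wpM2l //.
(* The product of two coordinates of [d] is at most [sqdist x y] in absolute value, because both
   squares are. *)
have := sqr_le_sqdist x y k; have := sqr_le_sqdist x y l.
rewrite !mxE ler_norml; set a := _ - _; set b := _ - _; nra.
Qed.

End sqdist.

Section flow.
Context {R : realType} {m : nat}.
Variables (g : 'cV[R]_m -> 'cV[R]_m) (Lam : set 'cV[R]_m).
Variable phi : R -> 'cV[R]_m -> 'cV[R]_m.
Hypothesis flow_phi : is_flow_on g Lam phi.

Lemma is_derive_flow y (t : R) k : Lam y ->
  is_derive t (1 : R) (fun s => phi s y k 0) (g (phi t y) k 0).
Proof.
by move=> Ly; apply: is_derive_coord; have [_ /(_ t)[]] := flow_phi Ly.
Qed.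

(** Gronwall's argument: the squared distance [E] of two trajectories satisfies [|E'| <= 2 K E], so
    multiplying it by a suitable exponential makes it monotone. *)
Lemma sqdist_flow (K t : R) x y :
  (forall x y, Lam x -> Lam y ->
    `|\sum_k (x k 0 - y k 0) * (g x k 0 - g y k 0)| <= K * sqdist x y) ->
  Lam x -> Lam y ->
  sqdist (phi t x) (phi t y) <= expR (2 * K * `|t|) * sqdist x y.
Proof.
move=> gK Lx Ly.
have [phi0x Lphix] := flow_phi Lx; have [phi0y Lphiy] := flow_phi Ly.
pose E (s : R) := sqdist (phi s x) (phi s y).
pose dE (s : R) := 2 * \sum_k (phi s x k 0 - phi s y k 0) *
  (g (phi s x) k 0 - g (phi s y) k 0).
have EdE (s : R) : is_derive s (1 : R) E (dE s).
  rewrite (_ : E =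
      \sum_k ((fun s => phi s x k 0) - (fun s => phi s y k 0)) ^+ 2).
    rewrite /dE mulr_sumr; apply: is_derive_sum => k.
    apply: is_derive_eq.
      by apply: is_deriveX; apply: is_deriveB; exact: is_derive_flow.
    by rewrite expr1 mulrA.
  by apply/funext => u; rewrite fct_sumE.
have dEK (s : R) : `|dE s| <= 2 * K * E s.
  rewrite /dE normrM ger0_norm // -mulrA ler_pM2l //.
  by apply: gK; [case: (Lphix s)|case: (Lphiy s)].
pose u (c s : R) := expR (c * s) * E s.
have ud (c s : R) : is_derive s (1 : R) (u c) (expR (c * s) * (dE s + c * E s)).
  have de : is_derive s (1 : R) (fun s => expR (c * s)) (expR (c * s) * c).
    have dl : is_derive s (1 : R) ( *%R c) c.
      rewrite (_ : *%R _ = c \*: id); last exact/funext.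
      by apply: is_derive_eq; rewrite [_ *: _]mulr1.
    by apply: is_derive_eq; rewrite mulrC.
  apply: is_derive_eq.
  rewrite /GRing.scale /=; ring.
have du (c s : R) : derivable (u c) s 1 by case: (ud c s).
have cu (c : R) (A : interval R) : {within [set` A], continuous (u c)}.
  by apply: derivable_within_continuous => s _.
(* Both time directions reduce to comparing [u c] at [t] and at 0: [c] is [- (2 * K)] for [t >= 0],
   where [u c] is nonincreasing, and [2 * K] for [t < 0], where it is nondecreasing. *)
suff : exists2 c, u c t <= u c 0 & - (c * t) = 2 * K * `|t|.
  move=> [c + <-]; rewrite /u mulr0 expR0 mul1r /E phi0x phi0y expRN.
  by rewrite ler_pdivlMl // expR_gt0.
have [t0|t0] := leP 0 t.
  exists (- (2 * K)); last by rewrite mulNr opprK ger0_norm.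
  have := @ler0_derive1_nincry _ (u (- (2 * K))) 0; apply => // s _.
  rewrite derive1E; have [_ ->] := ud (- (2 * K)) s.
  rewrite pmulr_rle0 ?expR_gt0 // mulNr subr_le0.
  exact: le_trans (ler_norm _) (dEK s).
exists (2 * K); last by rewrite ltr0_norm // mulrN.
have := @ger0_derive1_ndecrNy _ (u (2 * K)) 0; apply => //; last exact: ltW.
move=> s _; rewrite derive1E; have [_ ->] := ud (2 * K) s.
rewrite pmulr_rge0 ?expR_gt0 // -lerBlDr sub0r.
by have := dEK s; rewrite ler_norml => /andP[].
Qed.

(** The flow is given only as one trajectory per initial point. Continuity in the initial point
    comes from the Gronwall bound, with a Lipschitz constant of [g] on the compact set [Lam]. *)
Lemma flow_continuous r t : Cn r.+1 g -> compact Lam ->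
  {within Lam, continuous (phi t)}.
Proof.
move=> Cg cLam; have [K gK] := lipschitz_on_compact Cg cLam.
apply/subspace_continuousP => x Lx; apply/cvg_ballP => e e0.
pose C := expR (2 * K * `|t|).
have cq : continuous (fun y => C * sqdist x y).
  have cE : continuous (sqdist x).
    apply: (@Cn_sum _ _ _ 0) => k.
    rewrite (_ : (fun _ => _) =
        (fun y : 'cV[R]_m => (((x k 0)%:P - 'X) ^+ 2).[y k 0])).
      exact: (Cn_horner _ (Cn_coord k 0 (Cn_id 0))).
    by apply/funext => y; rewrite !hornerE.
  move=> y; apply: (@continuous_comp _ _ _ (sqdist x) ( *%R C)).
    exact: cE.
  exact: mulrl_continuous.
have near_x : \forall y \near x, C * sqdist x y < e ^+ 2.
  apply: (cvgr_lt _ (cq x)).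
  rewrite /sqdist big1 ?mulr0 ?exprn_gt0 // => k _.
  by rewrite subrr expr0n.
rewrite near_withinE; apply: filterS near_x => y xye Ly; split=> // k l.
rewrite [l]ord1 -ball_normE /= -ltr_sqr ?nnegrE ?normr_ge0 ?(ltW e0) //.
rewrite -normrX ger0_norm ?sqr_ge0 //; apply: le_lt_trans xye.
exact: le_trans (sqr_le_sqdist _ _ k) (sqdist_flow t gK Lx Ly).
Qed.

End flow.

(** * Borel measurability of functions continuous on a measurable set *)

Section borel.
Context {R : realType} {m : nat}.

Lemma open_measurable_Rm (A : set (Rm R m)) :
  open (A : set 'cV[R]_m) -> measurable A.
Proof. by move=> oA; exact: sub_sigma_algebra. Qed.

Lemma closed_measurable_Rm (A : set (Rm R m)) :
  closed (A : set 'cV[R]_m) -> measurable A.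
Proof.
by move=> /closed_openC/open_measurable_Rm/measurableC; rewrite setCK.
Qed.

Lemma compact_measurable_Rm (A : set (Rm R m)) :
  compact (A : set 'cV[R]_m) -> measurable A.
Proof.
by move=> cA; apply: closed_measurable_Rm; exact: compact_closed.
Qed.

Lemma measurable_set1_Rm (a : Rm R m) : measurable [set a].
Proof. by apply: compact_measurable_Rm; exact: compact_set1. Qed.

Lemma within_continuous_preimage_measurable {T : topologicalType}
    (D : set (Rm R m)) (f : 'cV[R]_m -> T) (U : set T) :
  measurable D -> {within D, continuous f} -> open U ->
  measurable (D `&` f @^-1` U : set (Rm R m)).
Proof.
move=> mD cf oU; have /continuousP/(_ U oU)/open_subspaceP[V oV VD] := cf.
by rewrite setIC -VD; apply: measurableI => //; exact: open_measurable_Rm.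
Qed.

Lemma within_continuous_measurable_Rm n (D : set (Rm R m))
    (f : 'cV[R]_m -> 'cV[R]_n) :
  measurable D -> {within D, continuous f} ->
  measurable_fun D (f : Rm R m -> Rm R n).
Proof.
move=> mD cf.
apply: (@measurability _ _ (Rm R m) (Rm R n) D f (@open 'cV[R]_n)) => //.
move=> _ [U oU <-].
exact: (@within_continuous_preimage_measurable 'cV[R]_n).
Qed.

Lemma within_continuous_measurable_real (D : set (Rm R m))
    (f : 'cV[R]_m -> R) :
  measurable D -> {within D, continuous f} ->
  measurable_fun D (f : Rm R m -> R).
Proof.
move=> mD cf.
apply: (@measurability _ _ (Rm R m) R D f _ (RGenOInfty.measurableE R)).
move=> _ [_ [x ->] <-].
by apply: within_continuous_preimage_measurable => //; exact: interval_open.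
Qed.

End borel.

(** * Mixing for bounded measurable functions *)

Section bounded_measurable.
Context d {T : measurableType d} {R : realType}.
Variables (mu : probability T R) (D : set T).
Hypotheses (mD : measurable D) (muD : mu D = 1%E).
Implicit Types (f g : T -> R) (A B : set T).

Definition bounded_measurable f :=
  measurable_fun D f /\ exists M : R, forall x, D x -> `|f x| <= M.

Lemma bm_integrable f : bounded_measurable f -> mu.-integrable D (EFin \o f).
Proof.
move=> [mf [M fM]]; apply: measurable_bounded_integrable => //.
  by apply: (le_lt_trans (probability_le1 mu mD)); rewrite ltry.
exists `|M|; split; first exact: num_real.
move=> N MN x Dx /=; apply: le_trans (fM x Dx) _.
exact: le_trans (ler_norm _) (ltW MN).
Qed.

Lemma bm_cst (r : R) : bounded_measurable (cst r).
Proof. by split; [exact: measurable_cst | exists `|r|]. Qed.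

Lemma bm_indic A : measurable A -> bounded_measurable \1_A.
Proof.
move=> mA; split; first exact: measurable_indic.
by exists 1 => x _; rewrite indicE; case: (_ \in _); rewrite ?normr1 ?normr0.
Qed.

Lemma bmD f g : bounded_measurable f -> bounded_measurable g ->
  bounded_measurable (fun x => f x + g x).
Proof.
move=> [mf [M fM]] [mg [N gN]]; split; first exact: measurable_funD.
by exists (M + N) => x Dx; rewrite (le_trans (ler_normD _ _)) // lerD ?fM ?gN.
Qed.

Lemma bmM f g : bounded_measurable f -> bounded_measurable g ->
  bounded_measurable (fun x => f x * g x).
Proof.
move=> [mf [M fM]] [mg [N gN]]; split; first exact: measurable_funM.
by exists (M * N) => x Dx; rewrite normrM ler_pM ?fM ?gN.
Qed.

Lemma bmZ (a : R) f : bounded_measurable f ->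
  bounded_measurable (fun x => a * f x).
Proof. by move=> bf; apply: bmM => //; exact: bm_cst. Qed.

Lemma bm_comp f (phi : T -> T) : measurable_fun D phi ->
  (forall x, D x -> D (phi x)) -> bounded_measurable f ->
  bounded_measurable (fun x => f (phi x)).
Proof.
move=> mphi Dphi [mf [M fM]]; split; last by exists M => x Dx; exact/fM/Dphi.
apply: (@measurable_comp _ _ _ _ _ _ D) => // _ [x Dx <-]; exact: Dphi.
Qed.

Lemma Rintegral_cst1 (r : R) : \int[mu]_(x in D) r = r.
Proof. by rewrite Rintegral_cst // [X in fine X]muD mulr1. Qed.

Lemma normr_Rintegral_le f (e : R) : bounded_measurable f ->
  (forall x, D x -> `|f x| <= e) -> `|\int[mu]_(x in D) f x| <= e.
Proof.
move=> bf fe; have intf := bm_integrable bf.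
rewrite (le_trans (le_normr_Rintegral mD intf)) //.
rewrite -[leRHS]Rintegral_cst1; apply: le_Rintegral => //.
- rewrite (_ : _ \o _ = abse \o (EFin \o f)) //; exact: integrable_abse.
- by apply: bm_integrable; exact: bm_cst.
Qed.

(** Convergence passes from indicators to bounded functions: [I t] and [J] respect the addition of
    multiples of indicators and are bounded by [K] times the sup norm, uniformly in [t], while
    bounded functions are uniform limits of simple ones. *)
Lemma bm_cvg (I : R -> (T -> R) -> R) (J : (T -> R) -> R) (K : R) f :
  (forall t g A a, 0 <= t -> bounded_measurable g -> measurable A ->
     I t (fun x => g x + a * \1_A x) = I t g + a * I t \1_A) ->
  (forall g A a, bounded_measurable g -> measurable A ->
     J (fun x => g x + a * \1_A x) = J g + a * J \1_A) ->
  (forall t g e, 0 <= t -> bounded_measurable g ->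
     (forall x, D x -> `|g x| <= e) -> `|I t g| <= K * e) ->
  (forall g e, bounded_measurable g ->
     (forall x, D x -> `|g x| <= e) -> `|J g| <= K * e) ->
  (forall A, measurable A -> I t \1_A @[t --> +oo] --> J \1_A) ->
  bounded_measurable f -> I t f @[t --> +oo] --> J f.
Proof.
move=> ID JD IK JK I1.
(* Splitting off [c/2] times the indicator of [c/2 <= g] halves the range of
   [g]. *)
have approx n : forall g (c e : R), bounded_measurable g ->
    (forall x, D x -> 0 <= g x <= c) -> 0 < e ->
    \forall t \near +oo, `|I t g - J g| <= 2 * K * c / 2 ^+ n + e.
  elim: n => [|n IH] g c e bg gc e0.
    near=> t; have t0 : 0 <= t by near: t; exact: nbhs_pinfty_ge.
    have ngc x : D x -> `|g x| <= c.
      by move=> /gc /andP[g0 gc']; rewrite ger0_norm.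
    rewrite expr0 divr1 (le_trans (ler_normB _ _)) //.
    by have := IK t g c t0 bg ngc; have := JK g c bg ngc; lra.
  pose A := D `&` g @^-1` `[c / 2, +oo[.
  have mA : measurable A by case: bg => mg _; exact: mg.
  pose h x := g x + - (c / 2) * \1_A x.
  have bh : bounded_measurable h.
    by apply: bmD => //; apply: bmZ; exact: bm_indic.
  have hc x : D x -> 0 <= h x <= c / 2.
    move=> Dx; have /andP[g0 gc'] := gc x Dx; rewrite /h indicE.
    have [Ax|nAx] := boolP (x \in A).
      move/set_mem: Ax; rewrite /A /= in_itv /= andbT => -[_ cg].
      by rewrite mulr1; lra.
    have : ~~ (c / 2 <= g x).
      apply: contra nAx => cg; apply/mem_set; split => //=.
      by rewrite in_itv /= andbT.
    by rewrite mulr0 -ltNge; lra.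
  have e2 : 0 < e / 2 by lra.
  have nearh := IH h (c / 2) (e / 2) bh hc e2.
  (* Chosen so that [|c / 2| * del <= e / 2]; adding 1 keeps the denominator positive. *)
  pose del := e / 2 / (`|c / 2| + 1).
  have del0 : 0 < del by rewrite divr_gt0 // ltr_wpDl.
  have near1 : \forall t \near +oo, `|J \1_A - I t \1_A| < del.
    by move/cvgrPdist_lt : (I1 A mA) => /(_ _ del0).
  near=> t; have t0 : 0 <= t by near: t; exact: nbhs_pinfty_ge.
  have Ih : I t h = I t g + - (c / 2) * I t \1_A by exact: ID.
  have Jh : J h = J g + - (c / 2) * J \1_A by exact: JD.
  have -> : I t g - J g = (I t h - J h) - (c / 2) * (J \1_A - I t \1_A).
    by rewrite Ih Jh; lra.
  rewrite (le_trans (ler_normB _ _)) // [e in leRHS]splitr addrA lerD //.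
    have -> : 2 * K * c / 2 ^+ n.+1 = 2 * K * (c / 2) / 2 ^+ n.
      by rewrite exprS invfM; lra.
    by near: t.
  have n1 : `|J \1_A - I t \1_A| < del by near: t.
  rewrite normrM -[leRHS](@divfK _ (`|c / 2| + 1)); last first.
    by rewrite gt_eqF // ltr_wpDl.
  by rewrite -/del mulrC ler_pM // ?(ltW n1) // lerDl.
have pos g c : bounded_measurable g -> (forall x, D x -> 0 <= g x <= c) ->
    I t g @[t --> +oo] --> J g.
  move=> bg gc; apply/cvgrPdist_le => e e0.
  have e2 : 0 < e / 2 by lra.
  have [n nE] : exists n, 2 * K * c / 2 ^+ n <= e / 2.
    have := cvg_geometric (2 * K * c) (_ : `|2^-1| < 1 :> R).
    rewrite ger0_norm // invf_lt1 ?ltr1n // => /(_ isT).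
    move=> /cvgr_le/(_ _ e2)[n _ /(_ n (leqnn n))] /=.
    by rewrite exprVn; exists n.
  near=> t; rewrite distrC.
  have : `|I t g - J g| <= 2 * K * c / 2 ^+ n + e / 2.
    by near: t; exact: approx.
  by lra.
move=> bf; have [mf [M fM]] := bf.
(* Adding [M] moves the values into [[0, 2 * M]], where [pos] applies. Writing the constant as a
   multiple of [\1_setT] lets [ID] and [JD] remove it afterwards. *)
have bf' : bounded_measurable (fun x => f x + M * \1_setT x).
  by apply: bmD => //; apply: bmZ; exact: bm_indic.
have f'M x : D x -> 0 <= f x + M * \1_setT x <= 2 * M.
  move=> /fM; rewrite indicE in_setT mulr1 ler_norml => /andP[] *; lra.
have c1 := pos _ _ bf' f'M.
have c2 := I1 setT measurableT.
have -> : J f = J (fun x => f x + M * \1_setT x) - M * J \1_setT.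
  by rewrite JD // addrK.
apply: (@cvg_trans _ (I t (fun x => f x + M * \1_setT x) - M * I t \1_setT
    @[t --> +oo])).
  apply: near_eq_cvg; near=> t.
  have t0 : 0 <= t by near: t; exact: nbhs_pinfty_ge.
  by rewrite ID // addrK.
apply: cvgB => //; exact: (cvgM (@cvg_cst _ M _ _ _) c2).
Unshelve. all: by end_near. Qed.

End bounded_measurable.

Section mixing.
Context d {T : measurableType d} {R : realType}.
Variables (mu : probability T R) (D : set T) (phi : R -> T -> T).
Hypotheses (mD : measurable D) (muD : mu D = 1%E).
Hypothesis mphi : forall t : R, 0 <= t -> measurable_fun D (phi t).
Hypothesis Dphi : forall (t : R) x, 0 <= t -> D x -> D (phi t x).
Hypothesis mix : forall A B, measurable A -> measurable B ->
  (fun t => mu (D `&` phi t @^-1` A `&` B)) @ +oo --> (mu A * mu B)%E.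

Let bm (f : T -> R) := bounded_measurable D f.

(** The complement of [D] is null, so intersecting [A] with [D] does not change its measure. *)
Lemma Rintegral_indic_full A : measurable A ->
  \int[mu]_(x in D) \1_A x = fine (mu A).
Proof.
move=> mA; rewrite /Rintegral integral_indic //; congr fine.
have muC : mu (~` D) = 0%E by rewrite probability_setC // muD subee.
apply/eqP; rewrite eq_le; apply/andP; split.
  by apply: le_measure; rewrite ?inE //; exact: measurableI.
have -> : mu A = mu ((A `&` D) `|` (A `&` ~` D)).
  by rewrite -setIUr setUv setIT.
apply: le_trans (measureU2 mu _ _) _.
- exact: measurableI.
- by apply: measurableI => //; exact: measurableC.
rewrite -[X in (_ <= X)%E]adde0 -muC; apply: leeD => //.
apply: le_measure; rewrite ?inE //.
  by apply: measurableI => //; exact: measurableC.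
exact: measurableC.
Qed.

Lemma mixing_indic A B : measurable A -> measurable B ->
  \int[mu]_(x in D) (\1_B x * \1_A (phi t x)) @[t --> +oo] -->
  (\int[mu]_(x in D) \1_B x) * (\int[mu]_(x in D) \1_A x).
Proof.
move=> mA mB; rewrite !Rintegral_indic_full // mulrC.
have := mix mA mB; rewrite -[mu A]fineK ?fin_num_measure // -[mu B]fineK
  ?fin_num_measure // -EFinM => /fine_cvg; apply: cvg_trans.
apply: near_eq_cvg; near=> t.
have t0 : 0 <= t by near: t; exact: nbhs_pinfty_ge.
have mS : measurable (D `&` phi t @^-1` A `&` B).
  by apply: measurableI => //; exact: mphi.
rewrite /= -Rintegral_indic_full //; apply: eq_Rintegral => x /set_mem Dx.
rewrite !indicE -natrM mulnb; congr (_%:R); congr nat_of_bool.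
apply/idP/andP => [/set_mem [[_ Ax] Bx]|[/set_mem Bx /set_mem Ax]].
  by split; exact: mem_set.
exact: mem_set.
Unshelve. all: by end_near. Qed.

(** Two passages from indicators to bounded functions: first in [w], with an indicator in place of
    [v], then in [v], with [w] fixed. The uniform bounds [K] are 1 and a bound of [w]. *)
Lemma mixing_bounded v w : bm v -> bm w ->
  \int[mu]_(x in D) (v x * w (phi t x)) @[t --> +oo] -->
  (\int[mu]_(x in D) v x) * (\int[mu]_(x in D) w x).
Proof.
have int f : bm f -> mu.-integrable D (EFin \o f) by exact: bm_integrable.
have bphi f t : 0 <= t -> bm f -> bm (fun x => f (phi t x)).
  move=> t0 bf; apply: bm_comp => //; first exact: mphi.
  by move=> x; exact: Dphi.
have linD f A a : bm f -> measurable A ->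
    \int[mu]_(x in D) (f x + a * \1_A x) =
    \int[mu]_(x in D) f x + a * \int[mu]_(x in D) \1_A x.
  move=> bf mA; rewrite RintegralD ?RintegralZl //; apply: int => //.
    exact: bm_indic.
  by apply: bmZ; exact: bm_indic.
have linDphi u f t A a : 0 <= t -> bm u -> bm f -> measurable A ->
    \int[mu]_(x in D) (u x * (f (phi t x) + a * \1_A (phi t x))) =
    \int[mu]_(x in D) (u x * f (phi t x)) +
    a * \int[mu]_(x in D) (u x * \1_A (phi t x)).
  move=> t0 bu bf mA.
  have bA : bm (fun x => u x * \1_A (phi t x)).
    by apply: bmM => //; apply: bphi => //; exact: bm_indic.
  rewrite -RintegralZl //; last exact: int.
  rewrite -RintegralD //; last 2 first.
    by apply: int; apply: bmM => //; exact: bphi.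
    by apply: int; exact: bmZ.
  by apply: eq_Rintegral => x _; rewrite mulrDr [u x * (a * _)]mulrCA.
have indic_w B : measurable B -> bm w ->
    \int[mu]_(x in D) (\1_B x * w (phi t x)) @[t --> +oo] -->
    (\int[mu]_(x in D) \1_B x) * (\int[mu]_(x in D) w x).
  move=> mB bw.
  have bB : bm \1_B by exact: bm_indic.
  have B1 x : `|\1_B x| <= 1 :> R.
    by rewrite indicE; case: (_ \in _); rewrite ?normr1 ?normr0.
  apply: (@bm_cvg _ _ _ D mD
    (fun t f => \int[mu]_(x in D) (\1_B x * f (phi t x)))
    (fun f => (\int[mu]_(x in D) \1_B x) * \int[mu]_(x in D) f x) 1) => //.
  - by move=> t g A a t0 bg mA; exact: linDphi.
  - by move=> g A a bg mA; rewrite linD // mulrDr mulrCA.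
  - move=> t g e t0 bg ge; apply: normr_Rintegral_le => //.
      by apply: bmM => //; exact: bphi.
    move=> x Dx; rewrite normrM ler_pM //; apply: ge; exact: Dphi.
  - move=> g e bg ge; rewrite normrM ler_pM //.
      exact: normr_Rintegral_le.
    exact: normr_Rintegral_le.
  - by move=> A mA; exact: mixing_indic.
move=> bv bw; have [_ [M wM]] := bw.
apply: (@bm_cvg _ _ _ D mD
  (fun t f => \int[mu]_(x in D) (f x * w (phi t x)))
  (fun f => (\int[mu]_(x in D) f x) * \int[mu]_(x in D) w x) M) => //.
- move=> t g A a t0 bg mA.
  have bA : bm (fun x => \1_A x * w (phi t x)).
    by apply: bmM; [exact: bm_indic | exact: bphi].
  rewrite -RintegralZl //; last exact: int.
  rewrite -RintegralD //; last 2 first.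
    by apply: int; apply: bmM => //; exact: bphi.
    by apply: int; exact: bmZ.
  by apply: eq_Rintegral => x _; rewrite mulrDl mulrA.
- by move=> g A a bg mA; rewrite linD // mulrDl mulrA.
- move=> t g e t0 bg ge; apply: normr_Rintegral_le => //.
    by apply: bmM => //; exact: bphi.
  by move=> x Dx; rewrite mulrC normrM ler_pM ?ge // wM //; exact: Dphi.
- move=> g e bg ge; rewrite mulrC normrM ler_pM //.
    exact: normr_Rintegral_le.
  exact: normr_Rintegral_le.
- by move=> A mA; exact: indic_w.
Qed.

End mixing.

(** * Time integrals of correlations along the flow *)

Section correlation.
Context d {T : measurableType d} {R : realType}.
Variables (mu : probability T R) (D : set T) (phi : R -> T -> T).
Hypotheses (mD : measurable D) (muD : mu D = 1%E).
Hypothesis mphi : forall t, measurable_fun D (phi t).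
Hypothesis Dphi : forall t x, D x -> D (phi t x).
Variables v w dw : T -> R.
Hypotheses (bv : bounded_measurable D v) (bw : bounded_measurable D w).
Hypothesis bdw : bounded_measurable D dw.
Hypothesis w_dw : forall (t : R) x, D x ->
  is_derive t (1 : R) (fun s => w (phi s x)) (dw (phi t x)).
Hypothesis dwc : forall x, D x -> continuous (fun s => dw (phi s x)).

Let C (f : T -> R) t := \int[mu]_(x in D) (v x * f (phi t x)).

Let bC f t : bounded_measurable D f ->
  bounded_measurable D (fun x => v x * f (phi t x)).
Proof. by move=> bf; apply: bmM => //; apply: bm_comp => // x; exact: Dphi. Qed.

Let dominate f : bounded_measurable D f ->
  exists2 M : R, 0 <= M &
    forall t x, D x -> `|v x * f (phi t x)| <= M.
Proof.
move=> [_ [M fM]]; have [_ [N vN]] := bv.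
exists (`|N| * `|M|); first by rewrite mulr_ge0.
move=> t x Dx; rewrite normrM ler_pM //.
  exact: le_trans (vN _ Dx) (ler_norm _).
exact: le_trans (fM _ (Dphi _ Dx)) (ler_norm _).
Qed.

(** Differentiation under the integral sign: the time derivative of the integrand is dominated by a
    constant, which is integrable for a probability measure. *)
Lemma is_derive_correlation (t : R) : is_derive t (1 : R) (C w) (C dw t).
Proof.
(* Any bounded open interval around [t] would do, since the dominating constant is uniform in
   time. *)
have It : `]t - 1, t + 1[%classic t by rewrite /= in_itv /=; lra.
have dvw (s : R) x : D x ->
    is_derive s (1 : R) (fun s => v x * w (phi s x)) (v x * dw (phi s x)).
  by move=> Dx; have := w_dw s Dx => dws; exact: is_deriveZ.
have [M M0 MM] := dominate bdw.
have intf s : `]t - 1, t + 1[%classic s ->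
    mu.-integrable D (EFin \o (fun x => v x * w (phi s x))).
  by move=> _; apply: bm_integrable => //; exact: bC.
have derf s x : `]t - 1, t + 1[%classic s -> D x ->
    derivable (fun s => v x * w (phi s x)) s 1.
  by move=> _ Dx; case: (dvw s x Dx).
have intM : mu.-integrable D (EFin \o cst M).
  by apply: bm_integrable => //; exact: bm_cst.
have d1E s x : D x ->
    partial1of2 (fun s x => v x * w (phi s x)) s x = v x * dw (phi s x).
  by move=> Dx; rewrite partial1of2E; case: (dvw s x Dx).
have ub s x : `]t - 1, t + 1[%classic s -> D x ->
    `|partial1of2 (fun s x => v x * w (phi s x)) s x| <= cst M x.
  by move=> _ Dx; rewrite d1E //; exact: MM.
apply: DeriveDef.
  exact: (derivable_under_integral mD It intf derf (fun _ => M0) intM ub).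
rewrite -derive1E.
rewrite (differentiation_under_integral mD It intf derf (fun _ => M0) intM ub).
by apply: eq_Rintegral => x /set_mem Dx; rewrite d1E.
Qed.

Lemma continuous_correlation : continuous (C dw).
Proof.
move=> t; have [M M0 MM] := dominate bdw.
have It : t \in `]t - 1, t + 1[%classic.
  by rewrite inE /= in_itv /=; apply/andP; split; lra.
apply: (@continuity_under_integral _ _ _ mu (fun s x => v x * dw (phi s x)) D mD
  (t - 1) (t + 1) _ _ (cst M) _ _ t It).
- by move=> s _; apply: bm_integrable => //; exact: bC.
- apply: aeW => x Dx s _.
  apply: (@continuous_comp _ _ _ (fun s => dw (phi s x)) ( *%R (v x))).
    exact: dwc.
  exact: mulrl_continuous.
- by apply: bm_integrable => //; exact: bm_cst.
- by move=> s _; apply: aeW => x Dx; exact: MM.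
Qed.

Lemma integral_correlation (S : R) : 0 < S ->
  Rintegral lebesgue_measure `[0, S] (C dw) = C w S - C w 0.
Proof.
move=> S0; have dC t : derivable (C w) t 1 by case: (is_derive_correlation t).
have cC : continuous (C w).
  by move=> t; apply/differentiable_continuous/derivable1_diffP.
rewrite /Rintegral (@continuous_FTC2 _ (C dw) (C w)) //.
- exact: continuous_subspaceT continuous_correlation.
- split => //.
    by apply: cvg_at_right_filter; exact: cC.
  by apply: cvg_at_left_filter; exact: cC.
- by move=> t _; rewrite derive1E; case: (is_derive_correlation t).
Qed.

Hypothesis mix : forall A B, measurable A -> measurable B ->
  (fun t => mu (D `&` phi t @^-1` A `&` B)) @ +oo --> (mu A * mu B)%E.
Hypothesis phi0 : forall x, D x -> phi 0 x = x.
Hypothesis v0 : \int[mu]_(x in D) v x = 0.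

(** [C w] is a primitive of [C dw]. Its value at 0 is the pairing of [v] and [w], and its limit is
    the product of their means, which is 0 because [v] is centered. *)
Lemma cvg_integral_correlation :
  2 * Rintegral lebesgue_measure `[0, S] (C dw) @[S --> +oo] -->
  - 2 * \int[mu]_(x in D) (v x * w x).
Proof.
have CwE : C w 0 = \int[mu]_(x in D) (v x * w x).
  by apply: eq_Rintegral => x /set_mem Dx; rewrite phi0.
have cC : C w S @[S --> +oo] --> (0 : R).
  have := mixing_bounded mD muD (fun t _ => mphi t)
    (fun t x _ Dx => Dphi t Dx) mix bv bw.
  by rewrite v0 mul0r.
apply: (@cvg_trans _ (2 * (C w S - C w 0) @[S --> +oo])).
  apply: near_eq_cvg; near=> S.
  by rewrite integral_correlation //; near: S; exact: nbhs_pinfty_gt.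
rewrite -CwE (_ : - 2 * C w 0 = 2 * (0 - C w 0)); last first.
  by rewrite sub0r mulrN mulNr.
have c0 : C w S - C w 0 @[S --> +oo] --> 0 - C w 0.
  exact: cvgB cC (@cvg_cst _ (C w 0) _ _ _).
exact: (cvgM (@cvg_cst _ (2 : R) _ _ _) c0).
Unshelve. all: by end_near. Qed.

End correlation.

(** * Gram matrices of centered powers *)

(** The set of points that are at [a] both now and at time [t] is empty or [[set a]], so its measure
    is 0 or [c]. Mixing gives the limit [c * c]; if [c > 0] this forces [c * c = c], so [c = 1] and
    the measure is Dirac. *)
Lemma mixing_atomless d (T : measurableType d) (R : realType)
    (mu : probability T R) (D : set T) (phi : R -> T -> T) (a : T) :
  measurable [set a] ->
  (forall A B, measurable A -> measurable B ->
    (fun t => mu (D `&` phi t @^-1` A `&` B)) @ +oo --> (mu A * mu B)%E) ->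
  ~ (forall A, measurable A -> mu A = \d_a A) ->
  mu [set a] = 0%E.
Proof.
move=> ma mix nD; pose c := fine (mu [set a]).
have muaE : mu [set a] = c%:E by rewrite fineK // fin_num_measure.
have c0 : 0 <= c by rewrite fine_ge0.
rewrite muaE; congr _%:E; apply: contra_notP nD => /eqP c_neq0 A mA.
have {c0 c_neq0} c_gt0 : 0 < c by rewrite lt_def c_neq0.
pose S t := D `&` phi t @^-1` [set a] `&` [set a].
have Sa t : mu (S t) = 0%E \/ mu (S t) = c%:E.
  have [[Da pa]|nS] := pselect (D a /\ phi t a = a).
    right; rewrite -muaE; congr (mu _); apply/seteqP; split=> [x []//|x /= ->].
    by split.
  left; rewrite (_ : S t = set0) ?measure0 //.
  by apply/seteqP; split=> // x [[Dx /= px] xa]; rewrite xa in Dx px; apply: nS.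
have := mix _ _ ma ma; rewrite muaE -EFinM => /fine_cvg /= Sc.
have Sc' : (fun t => fine (mu (S t))) @ +oo --> c.
  apply: (@cvg_trans _ (cst c @ (+oo : set_system R))); last exact: cvg_cst.
  apply: near_eq_cvg.
  (* The limit [c * c] is positive, so eventually the value 0 is excluded and the measure equals
     [c]. *)
  have S_gt0 := cvgr_gt _ Sc _ (mulr_gt0 c_gt0 c_gt0).
  near=> t; have : 0 < fine (mu (S t)) by near: t; exact: S_gt0.
  by case: (Sa t) => -> //=; rewrite ltxx.
have c1 : c = 1.
  have cc : c * c = c.
    by rewrite -[LHS](cvg_lim _ Sc) // -[RHS](cvg_lim _ Sc').
  by apply: (mulIf (lt0r_neq0 c_gt0)); rewrite mul1r.
rewrite diracE; have [aA|aA] := boolP (a \in A).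
  apply/eqP; rewrite eq_le probability_le1 //= -[leLHS]/(1%:E) -c1 -muaE.
  by apply: le_measure; rewrite ?inE // => x ->; exact/set_mem.
apply/eqP; rewrite -measure_le0.
have -> : 0%E = mu (~` [set a]) by rewrite probability_setC // muaE c1 subee.
apply: le_measure; rewrite ?inE //; first exact: measurableC.
by move=> x Ax xa; move/negP: aA; apply; rewrite -xa; exact: mem_set.
Unshelve. all: by end_near. Qed.

Lemma poly_roots_finite (R : fieldType) (p : {poly R}) : p != 0 ->
  exists s : seq R, forall x, root p x -> x \in s.
Proof.
elim: {p}_.+1 {-2}p (ltnSn (size p)) => // n IH p pn p0.
have [[x px]|nr] := pselect (exists x, root p x); last first.
  by exists [::] => x px; case: nr; exists x.
have [q pE] := factor_theorem p x px.
have q0 : q != 0 by apply: contraNneq p0 => q0; rewrite pE q0 mul0r.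
have [|s qs] := IH q _ q0.
  by move: pn; rewrite pE size_Mmonic ?monicXsubC // size_XsubC addn2.
exists (x :: s) => y; rewrite pE rootM root_XsubC inE => /orP[/qs ->|->] //.
by rewrite orbT.
Qed.

Section finitely_valued.
Context d {T : measurableType d} {R : realType}.
Variables (mu : probability T R) (D : set T).
Hypotheses (mD : measurable D) (muD : mu D = 1%E).

Definition finitely_valued (h : T -> R) :=
  exists s : seq R, {ae mu, forall x, D x -> h x \in s}.

Variable h : T -> R.
Hypotheses (bh : bounded_measurable D h) (nfv : ~ finitely_valued h).

Lemma bm_horner (p : {poly R}) : bounded_measurable D (fun x => p.[h x]).
Proof.
elim/poly_ind: p => [|p c IH].
  rewrite (_ : (fun _ => _) = cst 0); first exact: bm_cst.
  by apply/funext => x; rewrite horner0.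
rewrite (_ : (fun _ => _) = fun x => p.[h x] * h x + c).
  by apply: bmD; [exact: bmM | exact: bm_cst].
by apply/funext => x; rewrite hornerMXaddC.
Qed.

Let E (p : {poly R}) := \int[mu]_(x in D) p.[h x].

Let E_sum n (a : 'I_n -> R) (p : 'I_n -> {poly R}) :
  E (\sum_i a i *: p i) = \sum_i a i * E (p i).
Proof.
have ED p1 p2 : E (p1 + p2) = E p1 + E p2.
  rewrite /E -RintegralD //; try exact: bm_integrable (bm_horner _).
  by apply: eq_Rintegral => x _; rewrite hornerD.
have EZ c p1 : E (c *: p1) = c * E p1.
  rewrite /E -RintegralZl //; last exact: bm_integrable (bm_horner _).
  by apply: eq_Rintegral => x _; rewrite hornerZ.
have E0 : E 0 = 0.
  by rewrite -[X in E X](scale0r (0 : {poly R})) EZ mul0r.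
by rewrite (big_morph E ED E0); apply: eq_bigr => i _.
Qed.

(** A vanishing integral puts [h] almost everywhere among the roots of [p], and a nonzero [p] has
    only finitely many. This is the definiteness behind the invertible Gram matrix. *)
Lemma Rintegral_horner_sqr_eq0 (p : {poly R}) :
  \int[mu]_(x in D) (p ^+ 2).[h x] = 0 -> p = 0.
Proof.
move=> p2; apply: contra_notP nfv => /eqP /poly_roots_finite[s ps]; exists s.
have [mp2 _] := bm_horner (p ^+ 2).
have int2 := bm_integrable mu mD (bm_horner (p ^+ 2)).
have : (\int[mu]_(x in D) `|((p ^+ 2).[h x])%:E|)%E = 0%E.
  under eq_integral do
    rewrite abse_EFin horner_exp ger0_norm ?sqr_ge0 // -horner_exp.
  rewrite -[LHS]fineK; first by congr (_%:E).
  exact: integrable_fin_num.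
move=> /(ae_eq_integral_abs mu mD ((measurable_EFinP _ _).2 mp2)).
apply: filterS => x /= + Dx => /(_ Dx) [] /eqP.
by rewrite horner_exp expf_eq0 /= => px; exact: ps.
Qed.

(** With [G] the Gram matrix of the centered powers [q k], the combinations of the [q l] with
    coefficients [invmx G *m F] have the prescribed pairings. *)
Lemma centered_pairing m n (F : 'M[R]_(m, n)) :
  exists (q : 'I_m -> {poly R}) (w : 'I_n -> {poly R}),
    (forall i, \int[mu]_(x in D) (q i).[h x] = 0) /\
    (forall i j, \int[mu]_(x in D) ((q i).[h x] * (w j).[h x]) = F i j).
Proof.
(* Exponents start at 1, since centering the constant power would give 0. *)
pose q (k : 'I_m) : {poly R} := 'X^(k.+1) - (E 'X^(k.+1))%:P.
have Eq k : E (q k) = 0.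
  rewrite /E /q; under eq_Rintegral do rewrite hornerD hornerN hornerC.
  rewrite RintegralB //; first by rewrite Rintegral_cst1 // subrr.
    exact: bm_integrable (bm_horner _).
  exact: bm_integrable (bm_cst _ _).
pose G : 'M[R]_m := \matrix_(k, l) E (q k * q l).
(* A vector [u] in the left kernel gives a polynomial [Q] whose square has integral [u G u^T = 0],
   so [Q = 0]. *)
have Gu : G \in unitmx.
  rewrite -row_free_unit; apply: inj_row_free => u uG.
  pose Q := \sum_k u 0 k *: q k.
  have : E (Q ^+ 2) = 0.
    have -> : E (Q ^+ 2) = (u *m G *m u^T) 0 0.
      rewrite expr2 {1}/Q mulr_suml.
      under eq_bigr do rewrite -scalerAl.
      rewrite E_sum -mulmxA mxE; apply: eq_bigr => k _; congr (_ * _).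
      rewrite /Q mulr_sumr; under eq_bigr do rewrite -scalerAr.
      by rewrite E_sum mxE; apply: eq_bigr => l _; rewrite !mxE mulrC.
    by rewrite uG mul0mx mxE.
  move=> /Rintegral_horner_sqr_eq0 Q0; apply/rowP => k; rewrite mxE.
  (* Centering affects only degree 0, so the coefficient of degree [k.+1] in [Q] is the entry of [u]
     at [k]. *)
  have := congr1 (fun p : {poly R} => p`_k.+1) Q0.
  rewrite coef0 /Q coef_sum (bigD1 k) //= big1 => [|l lk].
    by rewrite addr0 coefZ coefB coefXn coefC eqxx subr0 mulr1.
  rewrite coefZ coefB coefXn coefC eqSS subr0 eq_sym.
  by rewrite (inj_eq val_inj) (negbTE lk) mulr0.
pose X := invmx G *m F.
exists q, (fun j => \sum_l X l j *: q l); split=> // i j.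
transitivity (E (q i * \sum_l X l j *: q l)).
  by apply: eq_Rintegral => x _; rewrite hornerM.
rewrite mulr_sumr; under eq_bigr do rewrite -scalerAr.
rewrite E_sum; transitivity ((G *m X) i j).
  by rewrite mxE; apply: eq_bigr => l _; rewrite !mxE mulrC.
by rewrite /X mulKVmx.
Qed.

End finitely_valued.

(** * Even observables *)

Section finitely_many_points.
Context {R : realType} {m : nat}.
Variables (mu : probability (Rm R m) R) (D : set (Rm R m)).
Hypotheses (mD : measurable D) (muD : mu D = 1%E).

(** Almost everywhere only finitely many quadratics [X^2 - a X + b] occur, each with finitely many
    roots. *)
Lemma finitely_valued_root (f1 f2 y : Rm R m -> R) :
  finitely_valued mu D f1 -> finitely_valued mu D f2 ->
  (forall x, D x -> y x ^+ 2 - f1 x * y x + f2 x = 0) ->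
  finitely_valued mu D y.
Proof.
move=> [s1 fs1] [s2 fs2] yroot.
pose p (a b : R) : {poly R} := 'X^2 - a *: 'X + b%:P.
have pn0 a b : p a b != 0.
  apply/eqP => /(congr1 (fun q : {poly R} => q`_2)) /eqP.
  by rewrite !coefE /= mulr0 subr0 addr0 oner_eq0.
pose rts a b := sval (cid (poly_roots_finite (pn0 a b))).
have rtsP a b x : root (p a b) x -> x \in rts a b.
  exact: (svalP (cid (poly_roots_finite (pn0 a b)))).
exists (flatten [seq rts a b | a <- s1, b <- s2]).
near=> x => Dx; apply/flattenP; exists (rts (f1 x) (f2 x)).
  apply: allpairs_f; move: Dx; near: x; [exact: fs1|exact: fs2].
by apply: rtsP; rewrite /root !hornerE yroot.
Unshelve. all: by end_near. Qed.

(** Otherwise almost every point of [D] would lie in a finite grid, which is null without atoms,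
    although [D] has measure 1. *)
Lemma atomless_not_finitely_valued :
  (forall a, mu [set a] = 0%E) ->
  ~ (forall k : 'I_m, finitely_valued mu D (fun y => y k 0)).
Proof.
move=> atomless /choice[s sP].
(* A common bound for positions in all the lists; the successor makes ['I_N] inhabited, as [inord]
   requires. Out-of-range positions read the default 0 and only add spare grid points. *)
pose N := (\max_k size (s k)).+1.
pose pt (f : {ffun 'I_m -> 'I_N}) : 'cV[R]_m := \col_k nth 0 (s k) (f k).
have points (l : seq 'cV[R]_m) : mu.-negligible ([set` l] : set (Rm R m)).
  elim: l => [|a l IH]; first by rewrite set_nil; exact: negligible_set0.
  have -> : [set` a :: l] = [set a] `|` [set` l].
    by apply/seteqP; split=> x /=; rewrite inE => /predU1P.
  apply: negligibleU => //.
  apply/negligibleP; last exact: atomless.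
  exact: measurable_set1_Rm.
pose pts := [seq pt f | f : {ffun 'I_m -> 'I_N}].
have Dpt : {ae mu, forall y, D y -> y \in pts}.
  have : {ae mu, forall y : Rm R m, forall k, D y -> y k 0 \in s k}.
    by apply: filter_forall => k; exact: sP.
  apply: filterS => y ys Dy; apply/mapP.
  exists [ffun k => inord (index (y k 0) (s k))]; first by rewrite mem_enum.
  apply/colP => k; rewrite mxE ffunE inordK ?nth_index ?ys //.
  rewrite /N ltnS; apply: leq_trans (leq_bigmax k).
  exact: index_size.
have : mu.-negligible D.
  apply: negligibleS (negligibleU Dpt (points pts)) => y Dy.
  have [yl|yl] := boolP (y \in pts); first by right.
  by left => /(_ Dy) yl'; move: yl; rewrite yl'.
move/(negligibleP mu mD); rewrite [X in X = _]muD => -[] /eqP.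
by rewrite oner_eq0.
Qed.

End finitely_many_points.

(** The change of variables [rho] preserves the measure and [D] but negates [f], so the integral
    equals its own opposite; it is finite, hence 0. *)
Lemma integral_odd_eq0 d (T : measurableType d) (R : realType)
    (mu : probability T R) (D : set T) (rho : T -> T) (f : T -> R) :
  measurable D -> measurable_fun setT rho ->
  (forall A, measurable A -> mu (rho @^-1` A) = mu A) ->
  rho @^-1` D = D ->
  measurable_fun setT f -> mu.-integrable D (EFin \o f) ->
  (forall x, D x -> f (rho x) = - f x) ->
  (\int[mu]_(x in D) (f x)%:E = 0)%E.
Proof.
move=> mD mrho murho rhoD mf intf fodd.
have frho : {in D, (EFin \o f) \o rho =1 (fun x => - (f x)%:E)%E}.
  by move=> x /set_mem Dx; rewrite /= fodd.
suff : (\int[mu]_(x in D) (f x)%:E = - \int[mu]_(x in D) (f x)%:E)%E.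
  have := integrable_fin_num mD intf.
  by case: (\int[mu]_(x in D) _)%E => // r _ [] rN; congr _%:E; lra.
rewrite -integralN; last by exact: integrable_add_def.
under [RHS]eq_integral => x xD do rewrite -frho //.
rewrite -[in RHS]rhoD -integral_pushforward //.
- by apply: eq_measure_integral => A mA _; exact: esym (murho A mA).
- exact/measurable_EFinP.
- rewrite rhoD; apply: (eq_integrable mD (fun x => - (f x)%:E)%E).
    by move=> x xD; rewrite frho.
  exact: integrableN.
Qed.

Lemma Cn_mulmx_coord (R : realType) (V : normedModType R) k m n
    (A : 'M[R]_(m, n)) (f : V -> 'cV[R]_n) i :
  Cn k f -> Cn k (fun x => (A *m f x) i 0).
Proof.
move=> Cf; rewrite (_ : (fun _ => _) = fun x => \sum_j A i j * f x j 0).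
  apply: Cn_sum => j; apply: (CnM (f := cst (A i j))); first exact: Cn_cst.
  exact: Cn_coord.
by apply/funext => x; rewrite mxE.
Qed.

Lemma is_derive_mulmx_coord (R : realType) (V : normedModType R) m n
    (A : 'M[R]_(m, n)) (f : V -> 'cV[R]_n) (t v : V) df i :
  is_derive t v f df -> is_derive t v (fun x => (A *m f x) i 0) ((A *m df) i 0).
Proof.
move=> fdf; rewrite (_ : (fun _ => _) = \sum_j (A i j \*o (fun x => f x j 0))).
  rewrite mxE; apply: is_derive_sum => j; apply: is_deriveZ.
  exact: is_derive_coord.
by apply/funext => x; rewrite mxE fct_sumE.
Qed.

(** * Even functions and their derivatives along the flow *)

Section even_observables.
Context {R : realType} {m : nat}.
Variables (r : nat) (g : 'cV[R]_m -> 'cV[R]_m) (Lam : set 'cV[R]_m).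
Variables (phi : R -> 'cV[R]_m -> 'cV[R]_m) (Rf : 'M[R]_m).
Hypotheses (Cg : Cn r g) (flow_phi : is_flow_on g Lam phi).
Hypothesis RfK : Rf *m Rf = 1%:M.
Hypothesis Rf_g : forall y, Lam y -> g (Rf *m y) = - (Rf *m g y).

(** [dh] is the derivative of [h] along the flow. It is required to be C^r as well because it
    becomes a factor of the minus part of [v]. *)
Definition even_observable (h dh : 'cV[R]_m -> R) :=
  [/\ Cn r h, Cn r dh,
      forall y, Lam y -> h (Rf *m y) = h y,
      forall y, Lam y -> dh (Rf *m y) = - dh y &
      forall (t : R) y, Lam y ->
        is_derive t (1 : R) (fun s => h (phi s y)) (dh (phi t y))].

Let C1 k : Cn r (fun y : 'cV[R]_m => y k 0).
Proof. exact: Cn_coord (Cn_id r). Qed.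
Let C2 k : Cn r (fun y : 'cV[R]_m => (Rf *m y) k 0).
Proof. exact: Cn_mulmx_coord (Cn_id r). Qed.
Let C3 k : Cn r (fun y : 'cV[R]_m => g y k 0).
Proof. exact: Cn_coord Cg. Qed.
Let C4 k : Cn r (fun y : 'cV[R]_m => (Rf *m g y) k 0).
Proof. exact: Cn_mulmx_coord Cg. Qed.
Let RfRf y : Rf *m (Rf *m y) = y :> 'cV[R]_m.
Proof. by rewrite mulmxA RfK mul1mx. Qed.
Let d1 (t : R) y k : Lam y ->
  is_derive t (1 : R) (fun s => phi s y k 0) (g (phi t y) k 0).
Proof. exact: is_derive_flow. Qed.
Let d2 (t : R) y k : Lam y -> is_derive t (1 : R)
  (fun s => (Rf *m phi s y) k 0) ((Rf *m g (phi t y)) k 0).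
Proof.
by move=> Ly; apply: is_derive_mulmx_coord; have [_ /(_ t)[]] := flow_phi Ly.
Qed.

(** No derivative is lost: [h] is linear in [y], so [dh] is linear in [g y] and as smooth as [g].
    Oddness of [dh] is the reversing relation for [g]. *)
Lemma even_observable_sum k : even_observable
  (fun y => y k 0 + (Rf *m y) k 0) (fun y => g y k 0 + (Rf *m g y) k 0).
Proof.
split.
- exact: CnD (C1 k) (C2 k).
- exact: CnD (C3 k) (C4 k).
- by move=> y Ly; rewrite RfRf addrC.
- by move=> y Ly; rewrite Rf_g // mulmxN RfRf !mxE opprD addrC.
- by move=> t y Ly; apply: is_deriveD; [exact: d1|exact: d2].
Qed.

Lemma even_observable_prod k : even_observable
  (fun y => y k 0 * (Rf *m y) k 0)
  (fun y => y k 0 * (Rf *m g y) k 0 + (Rf *m y) k 0 * g y k 0).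
Proof.
split.
- exact: CnM (C1 k) (C2 k).
- exact: CnD (CnM (C1 k) (C4 k)) (CnM (C2 k) (C3 k)).
- by move=> y Ly; rewrite RfRf mulrC.
- move=> y Ly; rewrite Rf_g // mulmxN !RfRf.
  have N (u : 'cV[R]_m) : (- u) k 0 = - u k 0 by rewrite mxE.
  by rewrite !N !mulrN opprD addrC.
- by move=> t y Ly; apply: is_deriveM; [exact: d1|exact: d2].
Qed.

End even_observables.

(** * Construction of an admissible observable with prescribed limit *)

Unset Implicit Arguments.

Theorem theorem4p3 (R : realType) (m r dp dm : nat)
  (Lam : set 'cV[R]_m) (g : 'cV[R]_m -> 'cV[R]_m)
  (phi : R -> 'cV[R]_m -> 'cV[R]_m)
  (mu : probability (Rm R m) R) (Rf : 'M[R]_m) :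
  (1 <= r)%N ->
  compact Lam ->
  Ck r g ->
  is_flow_on g Lam phi ->
  (* mu is a Borel probability measure on Lam *)
  mu (Lam : set (Rm R m)) = 1%E ->
  (* mu is g_t-invariant *)
  (forall (t : R) (A : set (Rm R m)), measurable A ->
     mu (Lam `&` phi t @^-1` A) = mu A) ->
  (* mu is ergodic *)
  (forall A : set (Rm R m), measurable A ->
     (forall t : R, Lam `&` phi t @^-1` A = Lam `&` A) ->
     mu A = 0%E \/ mu A = 1%E) ->
  (* mu is mixing *)
  (forall A B : set (Rm R m), measurable A -> measurable B ->
     (fun t : R => mu (Lam `&` phi t @^-1` A `&` B)) @ +oo
       --> (mu A * mu B)%E) ->
  (* the reversing symmetry R *)
  Rf *m Rf = 1%:M ->
  (fun y => Rf *m y) @` Lam = Lam ->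
  (forall A : set (Rm R m), measurable A ->
     mu ((fun y => Rf *m y) @^-1` A) = mu A) ->
  (forall y, Lam y -> g (Rf *m y) = - (Rf *m g y)) ->
  (* mu is not a Dirac mass *)
  ~ (exists a : Rm R m, forall A : set (Rm R m), measurable A ->
        mu A = \d_a A) ->
  forall F : 'M[R]_(dp, dm),
  exists v : 'cV[R]_m -> 'cV[R]_(dp + dm),
    @admissible R m dp dm r Lam mu Rf v /\
    forall (i : 'I_dp) (j : 'I_dm),
      E0_partial Lam mu phi v i j @ +oo --> F i j.
Proof.
move=> r1 cLam /Ck_Cn Cg flow_phi muLam _ _ mix RfK RfLam muRf Rf_g nDirac F.
have mLam : measurable (Lam : set (Rm R m)) by exact: compact_measurable_Rm.
have phi0 y : Lam y -> phi 0 y = y by move=> /flow_phi[].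
have Lphi t y : Lam y -> Lam (phi t y) by move=> /flow_phi[_ /(_ t)[]].
have RfRf y : Rf *m (Rf *m y) = y :> 'cV[R]_m by rewrite mulmxA RfK mul1mx.
have mphi t : measurable_fun (Lam : set (Rm R m)) (phi t : Rm R m -> Rm R m).
  apply: within_continuous_measurable_Rm => //.
  (* Here [1 <= r] provides the C^1 regularity behind the Lipschitz bound. *)
  by case: r r1 Cg => // r _ Cg; exact: flow_continuous Cg cLam.
have bm n (f : 'cV[R]_m -> R) : Cn n f ->
    bounded_measurable (Lam : set (Rm R m)) (f : Rm R m -> R).
  move=> /Cn_continuous cf; have cf' := @continuous_subspaceT _ _ Lam _ cf.
  split; first exact: within_continuous_measurable_real.
  by have [M _ fM] := compact_fun_bounded cf' cLam; exists M.
have atomless a : mu [set a] = 0%E.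
  apply: (mixing_atomless (measurable_set1_Rm a) mix) => aE.
  by apply: nDirac; exists a.
have [h [dh [[Ch Cdh h_even dh_odd h_dh] nfv]]] : exists h dh,
    even_observable r Lam phi Rf h dh /\ ~ finitely_valued mu Lam h.
  apply: contrapT => all_fv.
  apply: (atomless_not_finitely_valued mLam muLam atomless) => k.
  apply: (@finitely_valued_root _ _ mu Lam (fun y => y k 0 + (Rf *m y) k 0)
    (fun y => y k 0 * (Rf *m y) k 0)).
  - apply: contrapT => nfv; apply: all_fv; do 2 eexists; split; last exact: nfv.
    exact: even_observable_sum Cg flow_phi RfK Rf_g k.
  - apply: contrapT => nfv; apply: all_fv; do 2 eexists; split; last exact: nfv.
    exact: even_observable_prod Cg flow_phi RfK Rf_g k.
  (* A coordinate is one of the two roots of the quadratic whose other root is the reflected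
     coordinate. *)
  - by move=> y _; ring.
have bh := bm _ _ Ch.
(* The factor [- 2^-1] cancels the factor [- 2] in the limit of the correlation integrals. *)
have [q [w [q0 qw]]] := centered_pairing mLam muLam bh nfv (- 2^-1 *: F).
pose vp y : 'cV[R]_dp := \col_i (q i).[h y].
(* By the chain rule this is the derivative along the flow of [w j] evaluated at [h]: the
   coboundary, odd because [h] is even and [dh] is odd. *)
pose vm y : 'cV[R]_dm := \col_j ((w j)^`().[h y] * dh y).
pose v y := col_mx (vp y) (vm y).
have vpE i : vplus v i = fun y => (q i).[h y].
  by apply/funext => y; rewrite /vplus /v col_mxEu mxE.
have vmE j : vminus v j = fun y => (w j)^`().[h y] * dh y.
  by apply/funext => y; rewrite /vminus /v col_mxEd mxE.
have Cvp i : Cn r (vplus v i) by rewrite vpE; exact: Cn_horner.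
have Cvm j : Cn r (vminus v j).
  by rewrite vmE; exact: CnM (Cn_horner _ Ch) Cdh.
exists v; split; last first.
  move=> i j; have -> : F i j = - 2 * \int[mu]_(x in (Lam : set (Rm R m)))
      ((q i).[h x] * (w j).[h x]).
    by rewrite qw mxE mulrA mulrNN divff ?mul1r // pnatr_eq0.
  have dw t y : Lam y -> is_derive t (1 : R) (fun s => (w j).[h (phi s y)])
      (vminus v j (phi t y)).
    move=> Ly; rewrite vmE.
    exact: (@is_derive1_comp _ (horner (w j)) _ t _ _ (is_derive_poly _ _)
      (h_dh t y Ly)).
  have cvm y : Lam y -> continuous (fun s => vminus v j (phi s y)).
    move=> Ly s.
    apply: (@continuous_comp _ _ _ (fun s => phi s y) (vminus v j)).
      apply/differentiable_continuous/derivable1_diffP.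
      by have [_ /(_ s)[_ []]] := flow_phi y Ly.
    exact: Cn_continuous (Cvm j) _.
  have := @cvg_integral_correlation _ (Rm R m) R mu Lam phi mLam muLam mphi Lphi
    (fun y => (q i).[h y]) (fun y => (w j).[h y]) (vminus v j)
    (bm_horner bh _) (bm_horner bh _) (bm _ _ (Cvm j)) dw cvm mix phi0 (q0 i).
  by rewrite /E0_partial vpE.
split; [|split].
- apply/Ck_Cn/Cn_cV => k; case: (split_ordP k) => [i ->|j ->].
    exact: Cvp.
  exact: Cvm.
- move=> y Ly; rewrite /Amat /v mul_block_col mul1mx !mul0mx addr0 add0r.
  rewrite mulNmx mul1mx; congr col_mx; apply/colP => k; rewrite !mxE h_even //.
  by rewrite dh_odd // mulrN.
(* The plus components have mean zero by centering, the minus components by oddness under the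
   measure-preserving reflection. *)
- move=> k; case: (split_ordP k) => [i ->|j ->].
    have int_vp : mu.-integrable (Lam : set (Rm R m)) (EFin \o vplus v i).
      by apply: bm_integrable => //; exact: bm (Cvp i).
    have vp0 : Rintegral mu (Lam : set (Rm R m)) (vplus v i) = 0.
      by rewrite vpE; exact: q0.
    rewrite -[LHS]fineK; first by congr (_%:E); exact: vp0.
    exact: (integrable_fin_num mLam int_vp).
  apply: (@integral_odd_eq0 _ _ _ mu _ (fun y : Rm R m => Rf *m y : Rm R m)
    (vminus v j)) => //.
  + apply: within_continuous_measurable_Rm => //; apply: continuous_subspaceT.
    apply: (@Cn_continuous _ _ _ 0); apply: Cn_cV => k'.
    exact: Cn_mulmx_coord (Cn_id 0).
  (* The preimage of [Lam] equals its image because the reflection is an involution. *)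
  + apply/seteqP; split => y /=; rewrite -{1}RfLam.
      by move=> [z Lz /(congr1 (mulmx Rf))]; rewrite !RfRf => <-.
    by move=> [z Lz <-]; rewrite RfRf.
  + apply: within_continuous_measurable_real => //; apply: continuous_subspaceT.
    exact: Cn_continuous (Cvm j).
  + by apply: bm_integrable => //; exact: bm (Cvm j).
  + by move=> y Ly; rewrite vmE h_even // dh_odd // mulrN.
Qed.
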